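(* Let $\mathcal X,\mathcal Y$ be real infinite-dimensional separable Hilbert spaces, $\gamma=\mathcal N(0,C_{\mathcal X})$ a centered nondegenerate Gaussian measure on $\mathcal X$ with Cameron--Martin space $\mathcal E$. Let $F\in W^{1,4}_\gamma$. Then there exist constants $M_{H_{\mathcal X}}$ and $M_{H_{\mathcal Y}}$ (independent of $N$) such that for every $N\in\mathbb N$ the empirical sensitivity operators $$\widehat H_{\mathcal X}=\frac1N\sum_{k=1}^ND_{\mathcal E}F(x_k)^*D_{\mathcal E}F(x_k),\qquad\widehat H_{\mathcal Y}=\frac1N\sum_{k=1}^ND_{\mathcal E}F(x_k)D_{\mathcal E}F(x_k)^*$$ based on $N$ i.i.d. samples $x_k\sim\gamma$ satisfy $$\mathbb E_N\big[\|H_{\mathcal X}-\widehat H_{\mathcal X}\|^2_{\mathrm{HS}(\mathcal E,\mathcal E)}\big]\le\frac{M_{H_{\mathcal X}}}{N},\qquad\mathbb E_N\big[\|H_{\mathcal Y}-\widehat H_{\mathcal Y}\|^2_{\mathrm{HS}(\mathcal Y,\mathcal Y)}\big]\le\frac{M_{H_{\mathcal Y}}}{N},$$ where $\mathbb E_N$ is the expectation with respect to the random samples $(x_k)_{k=1}^N$.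
   Context: Setting. $C_{\mathcal X}$ is trace class and injective. $\mathcal E=\mathrm{Range}(C_{\mathcal X}^{1/2})$ with $\langle w_1,w_2\rangle_{\mathcal E}=\langle C_{\mathcal X}^{-1/2}w_1,C_{\mathcal X}^{-1/2}w_2\rangle_{\mathcal X}$. $\mathrm{HS}$ denotes Hilbert--Schmidt operators/norm. $H_{\mathcal X}=\mathbb E_\gamma[D_{\mathcal E}F^*D_{\mathcal E}F]$ on $\mathcal E$ and $H_{\mathcal Y}=\mathbb E_\gamma[D_{\mathcal E}F\,D_{\mathcal E}F^*]$ on $\mathcal Y$, adjoints being with respect to $\mathcal E,\mathcal Y$. Sobolev space. $\mathcal{FC}^\infty$ is the set of $F(x)=\sum_{i=1}^{M}\phi_i(\langle a_1,x\rangle_{\mathcal X},\dots,\langle a_n,x\rangle_{\mathcal X})y_i$ with $a_j\in\mathcal X$, $y_i\in\mathcal Y$, $\phi_i\in C_b^\infty(\mathbb R^n)$ (bounded together with all derivatives); $D_{\mathcal E}F(x)=DF(x)|_{\mathcal E}$; $W^{1,4}_\gamma$ is the completion of $\mathcal{FC}^\infty$ under $\|F\|^4_{W^{1,4}_\gamma}=\mathbb E_\gamma\|F\|_{\mathcal Y}^4+\mathbb E_\gamma\|D_{\mathcal E}F\|^4_{\mathrm{HS}(\mathcal E,\mathcal Y)}$, with $D_{\mathcal E}$ extended by continuity. *)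

(* Defs.v *)
From HB Require Import structures.
From mathcomp Require Import all_boot all_order all_algebra.
From mathcomp Require Import all_classical all_reals all_analysis.

Set Implicit Arguments.
Unset Strict Implicit.
Unset Printing Implicit Defensive.
Import Order.TTheory GRing.Theory Num.Theory.
Import numFieldNormedType.Exports.

Local Open Scope classical_set_scope.
Local Open Scope ring_scope.

HB.mixin Record NormedModule_hasInner (R : realType) H & NormedModule R H := {
  inner : H -> H -> R;
  innerC : forall x y, inner x y = inner y x;
  inner_linear : forall z, scalar (inner ^~ z);
  inner_norm : forall x, inner x x = `|x| ^+ 2
}.

#[short(type="hilbertType")]
HB.structure Definition Hilbert (R : realType) :=
  {H of CompleteNormedModule R H & NormedModule_hasInner R H}.

Section inner_theory.
Context {R : realType} {H : hilbertType R}.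
Implicit Types x y z : H.

Lemma innerDl x y z : inner (x + y) z = inner x z + inner y z.
Proof. by have := inner_linear z 1 x y; rewrite scale1r mul1r. Qed.

Lemma inner0l z : inner 0 z = 0.
Proof.
have h := innerDl 0 0 z; rewrite addr0 in h.
by apply: (@addrI _ (inner (0 : H) z)); rewrite addr0 -h.
Qed.

Lemma innerZl (a : R) x z : inner (a *: x) z = a * inner x z.
Proof. by have := inner_linear z a x 0; rewrite !addr0 inner0l addr0. Qed.

Lemma innerDr z x y : inner z (x + y) = inner z x + inner z y.
Proof. by rewrite innerC innerDl !(innerC _ z). Qed.

Lemma innerZr (a : R) z x : inner z (a *: x) = a * inner z x.
Proof. by rewrite innerC innerZl (innerC _ z). Qed.

End inner_theory.

Definition separable (T : topologicalType) : Prop :=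
  exists2 D : set T, countable D & dense D.

Definition infinite_dimensional (R : realType) (H : hilbertType R) : Prop :=
  ~ exists (n : nat) (v : 'I_n -> H),
      forall x, exists c : 'I_n -> R, x = \sum_(i < n) c i *: v i.

Definition orthonormal_basis (R : realType) (H : hilbertType R)
    (e : nat -> H) : Prop :=
  (forall i j, inner (e i) (e j) = (i == j)%:R) /\
  dense [set x : H | exists (n : nat) (c : nat -> R),
                       x = \sum_(i < n) c i *: e i].

Section operators.
Context {R : realType} {U V : hilbertType R}.

Definition adjoint (T : U -> V) : V -> U :=
  fun v => xget 0 [set u | forall h, inner (T h) v = inner h u].

(* Squared Hilbert-Schmidt norm, computed in the orthonormal basis e of the
   domain; the value does not depend on the orthonormal basis. *)
Definition hs_sqnorm (e : nat -> U) (T : U -> V) : \bar R :=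
  (\sum_(0 <= i <oo) (`|T (e i)| ^+ 2)%:E)%E.

Definition hilbert_schmidt (e : nat -> U) (T : U -> V) : Prop :=
  [/\ linear T, continuous T & (hs_sqnorm e T < +oo)%E].

End operators.

(* For nonnegative self-adjoint C, finiteness of the trace in one orthonormal
   basis is equivalent to finiteness in all of them. *)
Definition trace_class_nonneg (R : realType) (X : hilbertType R)
    (C : X -> X) : Prop :=
  exists2 b : nat -> X, orthonormal_basis b &
    (\sum_(0 <= i <oo) (inner (C (b i)) (b i))%:E < +oo)%E.

Record covariance_op (R : realType) (X : hilbertType R) := CovarianceOp {
  cov :> {linear X -> X};
  cov_continuous : continuous cov;
  cov_sym : forall x y, inner (cov x) y = inner x (cov y);
  cov_ge0 : forall x, 0 <= inner (cov x) x;
  cov_trace_class : trace_class_nonneg cov;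
  cov_inj : injective cov
}.

(* The (unique) nonnegative self-adjoint square root C^{1/2}. *)
Record sqrt_cov (R : realType) (X : hilbertType R) (C : covariance_op X) :=
  SqrtCov {
    cov_root :> {linear X -> X};
    cov_root_continuous : continuous cov_root;
    cov_root_sym : forall x y, inner (cov_root x) y = inner x (cov_root y);
    cov_root_ge0 : forall x, 0 <= inner (cov_root x) x;
    cov_root_sqr : forall x, cov_root (cov_root x) = C x
  }.

Lemma cov_root_inj (R : realType) (X : hilbertType R) (C : covariance_op X)
  (S : sqrt_cov C) : injective S.
Proof.
by move=> x y h; apply: (@cov_inj _ _ C); rewrite -!(cov_root_sqr S) h.
Qed.

Section cameron_martin.
Context {R : realType} {X : hilbertType R} {C : covariance_op X}.
Variable S : sqrt_cov C.

Definition cm_pred : pred X := fun w => `[< range S w >].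

Fact cm_pred_submod_closed : submod_closed cm_pred.
Proof.
split; first by apply/asboolP; exists 0 => //; rewrite linear0.
move=> a u v /asboolP[x _ <-] /asboolP[y _ <-]; apply/asboolP.
by exists (a *: x + y) => //; rewrite linearP.
Qed.

HB.instance Definition _ :=
  GRing.isSubmodClosed.Build R X cm_pred cm_pred_submod_closed.

Definition cameron_martin : Type := {w : X | cm_pred w}.

HB.instance Definition _ := Choice.on cameron_martin.
HB.instance Definition _ := SubType.on cameron_martin.
HB.instance Definition _ := [SubChoice_isSubZmodule of cameron_martin by <:].
HB.instance Definition _ := [SubZmodule_isSubLmodule of cameron_martin by <:].

(* w |-> C^{-1/2} w *)
Definition cov_root_inv (w : cameron_martin) : X :=
  xget 0 [set v | S v = \val w].

Lemma cov_root_invK w : S (cov_root_inv w) = \val w.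
Proof.
rewrite /cov_root_inv; case: xgetP => [v _ //|nex].
by have /asboolP[v _ vw] := valP w; case: (nex v).
Qed.

Fact cov_root_inv_linear : linear cov_root_inv.
Proof.
move=> a u v; apply: (@cov_root_inj _ _ _ S).
by rewrite linearP !cov_root_invK linearP.
Qed.

HB.instance Definition _ :=
  GRing.isLinear.Build R cameron_martin X _ cov_root_inv cov_root_inv_linear.

Fact cov_root_inv_normD u v :
  `|cov_root_inv (u + v)| <= `|cov_root_inv u| + `|cov_root_inv v|.
Proof. by rewrite linearD ler_normD. Qed.

Fact cov_root_inv_normZ (a : R) u :
  `|cov_root_inv (a *: u)| = `|a| * `|cov_root_inv u|.
Proof. by rewrite linearZ normrZ. Qed.

Fact cov_root_inv_norm0 u : `|cov_root_inv u| = 0 -> u = 0.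
Proof.
move=> /normr0_eq0 u0; apply: val_inj.
by rewrite -cov_root_invK u0 linear0.
Qed.

(* The topology and norm are those of the Cameron-Martin inner product,
   not the ones induced by X. *)
HB.instance Definition _ :=
  Lmodule_isNormed.Build R cameron_martin
    cov_root_inv_normD cov_root_inv_normZ cov_root_inv_norm0.

Definition cm_inner (u v : cameron_martin) : R :=
  inner (cov_root_inv u) (cov_root_inv v).

Fact cm_innerC u v : cm_inner u v = cm_inner v u.
Proof. exact: innerC. Qed.

Fact cm_inner_linear w : scalar (cm_inner ^~ w).
Proof. by move=> a u v; rewrite /cm_inner linearP innerDl innerZl. Qed.

Fact cm_inner_norm u : cm_inner u u = `|u| ^+ 2.
Proof. exact: inner_norm. Qed.

Lemma cm_normE (u : cameron_martin) : `|u| = `|cov_root_inv u|.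
Proof. by []. Qed.

Lemma cm_memP (x : X) : cm_pred (S x).
Proof. by apply/asboolP; exists x. Qed.

Lemma cov_root_invE (x : X) (h : cm_pred (S x)) :
  cov_root_inv (exist _ (S x) h) = x.
Proof. by apply: (@cov_root_inj _ _ _ S); rewrite cov_root_invK. Qed.

Fact cm_complete (F : set_system cameron_martin) :
  ProperFilter F -> cauchy F -> cvg F.
Proof.
move=> FF Fc.
have Gc : cauchy (cov_root_inv @ F).
  apply/cauchy_ballP => eps eps0.
  have /cauchy_ballP/(_ eps eps0) := Fc.
  case=> -[A B]/= [FA FB] AB.
  exists (cov_root_inv @` A, cov_root_inv @` B) => /=.
    by split; rewrite /nbhs/= /fmap/=;
      [apply: filterS FA | apply: filterS FB] => w Aw /=; exists w.
  move=> [_ _]/= [[u Au <-] [v Bv <-]].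
  have /= := AB (u, v) (conj Au Bv).
  by rewrite -!ball_normE/= /ball_/= cm_normE linearB.
have /cauchy_cvg/cvg_ex[x Gx] := Gc.
apply/cvg_ex; exists (exist _ (S x) (cm_memP x)).
apply/cvgrPdist_lt => eps eps0.
have /cvgrPdist_lt/(_ eps eps0) := Gx.
apply: filterS => w /=.
by rewrite cm_normE linearB/= cov_root_invE.
Qed.

HB.instance Definition _ := Uniform_isComplete.Build cameron_martin cm_complete.

HB.instance Definition _ := NormedModule_hasInner.Build R cameron_martin
  cm_innerC cm_inner_linear cm_inner_norm.

End cameron_martin.

Notation borel X := (g_sigma_algebraType (@open X)).

(* gamma = N(0, C): each functional <a, .> has law N(0, <C a, a>).  The law is
   a Dirac mass when the variance vanishes, a case in which normal_prob is not
   the degenerate normal law. *)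
Definition centered_gaussian (R : realType) (X : hilbertType R)
    (gamma : probability (borel X) R) (C : X -> X) : Prop :=
  forall (a : X) (B : set (measurableTypeR R)), measurable B ->
    pushforward gamma (fun x : borel X => inner a x : measurableTypeR R) B =
    if inner (C a) a == 0 then \d_(0 : R) B
    else normal_prob 0 (Num.sqrt (inner (C a) a)) B.

Section smooth_bounded.
Context {R : realType} {n : nat}.

Definition partial (phi : 'rV[R]_n -> R) (s : seq 'I_n) : 'rV[R]_n -> R :=
  foldr (fun i f x => 'D_(delta_mx 0 i) f x) phi s.

Definition Cb_infty (phi : 'rV[R]_n -> R) : Prop :=
  forall s : seq 'I_n,
    (forall x, differentiable (partial phi s) x) /\
    exists c : R, forall x, `|partial phi s x| <= c.

End smooth_bounded.

Definition cylindrical (R : realType) (X Y : hilbertType R)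
    (F : X -> Y) : Prop :=
  exists (n M : nat) (a : 'I_n -> X) (y : 'I_M -> Y)
         (phi : 'I_M -> 'rV[R]_n -> R),
    (forall i, Cb_infty (phi i)) /\
    F = fun x => \sum_(i < M) phi i (\row_j inner (a j) x) *: y i.

Section sobolev.
Context {R : realType} {X Y : hilbertType R} {C : covariance_op X}.
Variables (S : sqrt_cov C) (gamma : probability (borel X) R).
Local Notation E := (cameron_martin S).

Definition cm_diff (F : X -> Y) (x : X) : E -> Y := fun w => 'd F x (\val w).

Definition sobolev_norm4 (e : nat -> E) (F : X -> Y) (DF : X -> E -> Y)
    : \bar R :=
  ((\int[gamma]_x (`|F x| ^+ 4)%:E) +
   (\int[gamma]_x (hs_sqnorm e (DF x) ^+ 2)))%E.

(* The completion of the cylindrical functions is realized in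
   L^4(gamma; Y) x L^4(gamma; HS(E, Y)) as the closure of the pairs
   (F, D_E F): sobolev14 e F DF states that F is in W^{1,4} and that DF is (a
   version of) its derivative D_E F extended by continuity.  As HS(E, Y) is
   separable, measurability of x |-> DF x w for each w is Borel measurability
   of DF into HS(E, Y). *)
Definition sobolev14 (e : nat -> E) (F : X -> Y) (DF : X -> E -> Y) : Prop :=
  [/\ measurable_fun setT (F : borel X -> borel Y),
      forall x, hilbert_schmidt e (DF x),
      forall w, measurable_fun setT ((fun x => DF x w) : borel X -> borel Y) &
      exists Fn : nat -> X -> Y, (forall n, cylindrical (Fn n)) /\
        sobolev_norm4 e (fun x => F x - Fn n x)
                        (fun x w => DF x w - cm_diff (Fn n) x w)
          @[n --> \oo] --> 0%E].

End sobolev.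

(* Expectation of a random operator A in the weak sense:
   <E[A] h, k> = E <A h, k> for all h and k.  It agrees with the Bochner
   expectation when the Hilbert-Schmidt norm of A is integrable. *)
Definition op_expectation d (T : measurableType d) (R : realType)
    (P : probability T R) (U : hilbertType R) (A : T -> U -> U) : U -> U :=
  fun h => xget 0 [set m | forall k,
    P.-integrable setT (fun t => (inner (A t h) k)%:E) /\
    ((inner m k)%:E = \int[P]_t (inner (A t h) k)%:E)%E].

(* Independence is the product rule over all N indices; subfamilies are
   covered by taking A k = setT. *)
Definition iid_samples d (Om : measurableType d) (R : realType)
    (P : probability Om R) d' (T : measurableType d')
    (mu : probability T R) (N : nat) (x : 'I_N -> Om -> T) : Prop :=
  [/\ forall k, measurable_fun setT (x k),
      forall k (A : set T), measurable A -> P (x k @^-1` A) = mu A &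
      forall A : 'I_N -> set T, (forall k, measurable (A k)) ->
        P (\bigcap_k (x k @^-1` A k)) = (\prod_(k < N) P (x k @^-1` A k))%E].

Section sensitivity.
Context {R : realType} {X E Y : hilbertType R}.
Variables (gamma : probability (borel X) R) (DF : X -> E -> Y).

Definition sensitivity_X : E -> E :=
  op_expectation gamma (fun x h => adjoint (DF x) (DF x h)).

Definition sensitivity_Y : Y -> Y :=
  op_expectation gamma (fun x y => DF x (adjoint (DF x) y)).

Definition emp_sensitivity_X (N : nat) (x : 'I_N -> X) : E -> E :=
  fun h => N%:R^-1 *: \sum_(k < N) adjoint (DF (x k)) (DF (x k) h).

Definition emp_sensitivity_Y (N : nat) (x : 'I_N -> X) : Y -> Y :=
  fun y => N%:R^-1 *: \sum_(k < N) DF (x k) (adjoint (DF (x k)) y).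

End sensitivity.

(* Main.v *)
Require Import Defs.
From HB Require Import structures.
From mathcomp Require Import all_boot all_order all_algebra.
From mathcomp Require Import all_classical all_reals all_analysis.
From mathcomp Require Import measurable_realfun ring lra.

Set Implicit Arguments.
Unset Strict Implicit.
Unset Printing Implicit Defensive.
Import Order.TTheory GRing.Theory Num.Theory.
Import numFieldNormedType.Exports.

Local Open Scope classical_set_scope.
Local Open Scope ring_scope.

(** Both estimates are the variance bound for an empirical mean, read in a
    Hilbert space of Hilbert-Schmidt operators.  Write [T = D_E F(x)] and
    [r(x)] for the squared Hilbert-Schmidt norm of [T].  The operators [T^* T]
    and [T T^*] have operator norm at most [r(x)] and squared Hilbert-Schmidt
    norm at most [r(x)^2] ([norm_adjointT_le], [hs_sqnorm_adjointT_le] and their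
    counterparts for [T T^*]), so that [E r^2] can serve as both constants.

    [E r^2] is finite because [D_E F] is at finite distance in L^4 from the
    derivative of some cylindrical function, and that derivative is bounded in
    Hilbert-Schmidt norm uniformly in [x] ([cylindrical_bounded_hs],
    [sobolev14_fourth_moment]).

    For a random operator [A] that is dominated in this way,
    [random_operator_error] computes the expected squared error entry by entry.
    By Parseval's identity the squared Hilbert-Schmidt norm of the error is the
    double series of its squared matrix entries in an orthonormal basis.  The
    expectation passes inside the series by positivity.  Each entry is the error
    of an empirical mean of real random variables, where independence kills the
    covariances and leaves [E (a_ij^2) / N] ([empirical_mean_variance]).  The
    sum over the entries is then at most [E r^2 / N].

    The adjoint and the weak expectation are both given by vectors characterised
    through their inner products.  Their existence is the Riesz representation
    theorem ([Riesz]), used in [adjointE] and [op_expectationE]; the entries of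
    the error can be computed only once it is known. *)

(** * Inner products and orthonormal bases *)

Section inner_product.
Context {R : realType} {H : hilbertType R}.
Implicit Types x y z u v : H.

Lemma inner0r z : inner z 0 = 0.
Proof. by rewrite innerC inner0l. Qed.

Lemma innerBl x y z : inner (x - y) z = inner x z - inner y z.
Proof. by rewrite innerDl -scaleN1r innerZl mulN1r. Qed.

Lemma innerBr z x y : inner z (x - y) = inner z x - inner z y.
Proof. by rewrite innerC innerBl !(innerC _ z). Qed.

Lemma inner_suml (I : Type) (r : seq I) (P : pred I) (g : I -> H) z :
  inner (\sum_(i <- r | P i) g i) z = \sum_(i <- r | P i) inner (g i) z.
Proof.
apply: (big_morph (fun u => inner u z)) => [x y|]; first exact: innerDl.
exact: inner0l.
Qed.

Lemma inner_sumr (I : Type) (r : seq I) (P : pred I) (g : I -> H) z :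
  inner z (\sum_(i <- r | P i) g i) = \sum_(i <- r | P i) inner z (g i).
Proof. by rewrite innerC inner_suml; under eq_bigr do rewrite innerC. Qed.

Lemma sqr_normD x y : `|x + y| ^+ 2 = `|x| ^+ 2 + 2 * inner x y + `|y| ^+ 2.
Proof. by rewrite -!inner_norm innerDl !innerDr (innerC y x); ring. Qed.

Lemma sqr_normB x y : `|x - y| ^+ 2 = `|x| ^+ 2 - 2 * inner x y + `|y| ^+ 2.
Proof. by rewrite -!inner_norm innerBl !innerBr (innerC y x); ring. Qed.

Lemma sqr_normD_le x y : `|x + y| ^+ 2 <= 2 * `|x| ^+ 2 + 2 * `|y| ^+ 2.
Proof.
have := sqr_ge0 (`|x - y|); rewrite sqr_normB sqr_normD; lra.
Qed.

Lemma inner_polarization x y :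
  inner x y = (`|x + y| ^+ 2 - `|x| ^+ 2 - `|y| ^+ 2) / 2.
Proof. by rewrite sqr_normD; field. Qed.

Lemma sqr_normZ (a : R) x : `|a *: x| ^+ 2 = a ^+ 2 * `|x| ^+ 2.
Proof. by rewrite -!inner_norm innerZl innerZr mulrA. Qed.

(** Expand the squared norm of [|y|^2 x - <x, y> y]: this multiple of the
    residual of the projection on [y] avoids a division. *)
Lemma Cauchy_Schwarz x y : `|inner x y| <= `|x| * `|y|.
Proof.
have [->|y0] := eqVneq y 0; first by rewrite inner0r normr0 mulr_ge0.
have ny : 0 < `|y| by rewrite normr_gt0.
have := sqr_ge0 `|(`|y| ^+ 2) *: x - inner x y *: y|.
rewrite sqr_normB innerZl innerZr !sqr_normZ.
move=> h; rewrite -ler_sqr ?nnegrE ?mulr_ge0// real_normK ?num_real//.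
rewrite exprMn; have y2 : 0 < `|y| ^+ 2 by rewrite exprn_gt0.
rewrite -(ler_pM2l y2); move: h; set a := `|y|; set b := `|x|; set c := inner _ _.
move=> h; rewrite -subr_ge0; apply: le_trans h _.
by rewrite le_eqVlt; apply/orP; left; apply/eqP; ring.
Qed.

Lemma inner_continuous z : continuous (fun x : H => inner z x).
Proof.
move=> x; apply/cvgrPdist_lt => eps eps0; near=> y.
rewrite -innerBr (le_lt_trans (Cauchy_Schwarz _ _))//.
have z1 : 0 < `|z| + 1 by rewrite ltr_wpDl.
apply: (@le_lt_trans _ _ ((`|z| + 1) * `|x - y|)).
  by rewrite ler_wpM2r// lerDl.
rewrite -ltr_pdivlMl//; near: y; apply: cvgr_dist_lt => //.
by rewrite mulr_gt0// invr_gt0.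
Unshelve. all: by end_near. Qed.

Lemma sqr_norm_continuous : continuous (fun x : H => `|x| ^+ 2).
Proof.
by move=> x; apply: cvgM; apply: cvg_norm.
Qed.

End inner_product.

Section orthonormal.
Context {R : realType} {H : hilbertType R} (e : nat -> H).
Hypothesis e_on : forall i j, inner (e i) (e j) = (i == j)%:R.
Implicit Types (u v : H) (c : nat -> R).

Lemma inner_comb (r : seq nat) c j : uniq r ->
  inner (\sum_(i <- r) c i *: e i) (e j) = if j \in r then c j else 0.
Proof.
move=> ur; rewrite inner_suml.
under eq_bigr do rewrite innerZl e_on.
have [jr|jr] := boolP (j \in r).
  rewrite (bigD1_seq j)//= eqxx mulr1 big1 ?addr0// => i /negbTE ->.
  by rewrite mulr0.
rewrite big_seq big1// => i ir.
have /negbTE -> : i != j by apply: contraNneq jr => <-.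
by rewrite mulr0.
Qed.

Lemma sqr_norm_comb (r : seq nat) c : uniq r ->
  `|\sum_(i <- r) c i *: e i| ^+ 2 = \sum_(i <- r) c i ^+ 2.
Proof.
move=> ur; rewrite -inner_norm inner_sumr; apply: eq_big_seq => i ir.
by rewrite innerZr inner_comb// ir expr2.
Qed.

(** Completing the square: the Fourier coefficients are the best choice of [c],
    whence Bessel's inequality and, when the span is dense, Parseval's identity. *)
Lemma sqr_norm_sub_comb u n c :
  `|u - \sum_(i < n) c i *: e i| ^+ 2 =
  `|u| ^+ 2 - \sum_(i < n) inner u (e i) ^+ 2
   + \sum_(i < n) (c i - inner u (e i)) ^+ 2.
Proof.
rewrite sqr_normB inner_sumr.
have -> : \sum_(i < n) c i *: e i = \sum_(i <- iota 0 n) c i *: e i.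
  by rewrite -(big_mkord xpredT (fun i => c i *: e i)) /index_iota subn0.
rewrite sqr_norm_comb ?iota_uniq//.
have -> : \sum_(i <- iota 0 n) c i ^+ 2 = \sum_(i < n) c i ^+ 2.
  by rewrite -(big_mkord xpredT (fun i => c i ^+ 2)) /index_iota subn0.
rewrite -!addrA; congr (_ + _).
rewrite mulr_sumr -!sumrN -!big_split/=; apply: eq_bigr => i _.
rewrite innerZr; ring.
Qed.

Lemma Bessel u n : \sum_(i < n) inner u (e i) ^+ 2 <= `|u| ^+ 2.
Proof.
have := sqr_norm_sub_comb u n (fun i => inner u (e i)).
rewrite [X in _ = _ + X]big1 ?addr0; last by move=> i _; rewrite subrr expr0n.
by move=> h; rewrite -subr_ge0 -h sqr_ge0.
Qed.

Lemma Bessel_series u :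
  (\sum_(0 <= i <oo) (inner u (e i) ^+ 2)%:E <= (`|u| ^+ 2)%:E)%E.
Proof.
apply: lime_le.
  by apply: is_cvg_nneseries => i _ _; rewrite lee_fin sqr_ge0.
by apply: nearW => n; rewrite big_mkord sumEFin lee_fin Bessel.
Qed.

End orthonormal.

Section orthonormal_basis.
Context {R : realType} {H : hilbertType R} (e : nat -> H).
Hypothesis e_onb : orthonormal_basis e.
Implicit Types (u v : H).

Lemma onb_approx u (eps : R) : 0 < eps ->
  exists (n : nat) (c : nat -> R), `|u - \sum_(i < n) c i *: e i| < eps.
Proof.
move=> eps0; have [_ de] := e_onb.
have [|v [uv [n [c vE]]]] := de (ball u eps) _ (ball_open u eps).
  by exists u; exact: ballxx.
by exists n, c; rewrite -vE; move: uv; rewrite -ball_normE.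
Qed.

(** Bessel's inequality is an equality because the partial Fourier sums of [u]
    approximate it at least as well as any combination of the [e i]. *)
Lemma Parseval u :
  (\sum_(0 <= i <oo) (inner u (e i) ^+ 2)%:E = (`|u| ^+ 2)%:E)%E.
Proof.
have [e_on _] := e_onb.
apply/eqP; rewrite eq_le Bessel_series//=; apply/lee_addgt0Pr => eps eps0.
have [|n [c uc]] := @onb_approx u (Num.sqrt eps); first by rewrite sqrtr_gt0.
have : `|u - \sum_(i < n) c i *: e i| ^+ 2 < eps.
  by rewrite -[ltRHS]sqr_sqrtr ?ltW// ltr_pXn2r ?nnegrE ?sqrtr_ge0.
rewrite sqr_norm_sub_comb// => h.
apply: (@le_trans _ _ ((\sum_(i < n) inner u (e i) ^+ 2)%:E + eps%:E)%E).
  rewrite -EFinD lee_fin; have : 0 <= \sum_(i < n) (c i - inner u (e i)) ^+ 2.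
    by apply: sumr_ge0 => i _; exact: sqr_ge0.
  by move: h; lra.
rewrite leeD2r// -sumEFin -(big_mkord xpredT (fun i => (inner u (e i) ^+ 2)%:E)).
by apply: nneseries_lim_ge => i _ _; rewrite lee_fin sqr_ge0.
Qed.

(** The representing vector is the sum of the series with coefficients
    [phi (e i)]: testing the bound on [phi] against the partial sums shows that
    these coefficients are square summable, so completeness applies. *)
Lemma Riesz (phi : H -> R) (K : R) :
  (forall (a : R) x y, phi (a *: x + y) = a * phi x + phi y) ->
  (forall x, `|phi x| <= K * `|x|) ->
  exists u, forall h, phi h = inner h u.
Proof.
have [e_on _] := e_onb => philin phiK.
have phi0 : phi 0 = 0.
  by have := philin 1 0 0; rewrite scaler0 addr0 mul1r; lra.
have phiD x y : phi (x + y) = phi x + phi y.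
  by have := philin 1 x y; rewrite scale1r mul1r.
have phiZ a x : phi (a *: x) = a * phi x.
  by have := philin a x 0; rewrite !addr0 phi0 addr0.
have phi_sum (r : seq nat) c :
    phi (\sum_(i <- r) c i *: e i) = \sum_(i <- r) c i * phi (e i).
  by rewrite (big_morph phi phiD phi0); under eq_bigr do rewrite phiZ.
pose t k := phi (e k) *: e k.
have coef_bound n : \sum_(0 <= i < n) phi (e i) ^+ 2 <= K ^+ 2.
  set q := \sum_(_ <= _ < _) _.
  have q0 : 0 <= q by apply: sumr_ge0 => i _; exact: sqr_ge0.
  have := phiK (\sum_(0 <= i < n) t i).
  rewrite phi_sum; under eq_bigr do rewrite -expr2.
  rewrite -/q ger0_norm// => qK.
  have nE : `|\sum_(0 <= i < n) t i| ^+ 2 = q by rewrite sqr_norm_comb ?iota_uniq.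
  have : q ^+ 2 <= K ^+ 2 * q.
    by rewrite -nE -exprMn nE ler_sqr ?nnegrE// (le_trans q0).
  have [->|qn0] := eqVneq q 0; first by rewrite sqr_ge0.
  by rewrite expr2 ler_pM2r// lt_def qn0.
have cvg_coef : cvgn (series (fun i => phi (e i) ^+ 2)).
  apply: nondecreasing_is_cvgn.
    apply/nondecreasing_seqP => n.
    by rewrite !seriesEnat/= big_nat_recr//= lerDl sqr_ge0.
  by exists (K ^+ 2) => _ [n _ <-]; rewrite seriesEnat; exact: coef_bound.
have : cvgn (series t).
  apply/cauchy_cvgP/cauchy_seriesP => eps eps0.
  move/cauchy_cvgP/cauchy_seriesP : cvg_coef => /(_ (eps ^+ 2) (exprn_gt0 _ eps0)).
  apply: filterS => -[m n]/=.
  rewrite ger0_norm; last by apply: sumr_ge0 => i _; exact: sqr_ge0.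
  rewrite -(@sqr_norm_comb _ _ _ e_on (index_iota m n) (phi \o e)) ?iota_uniq//.
  by rewrite ltr_pXn2r// nnegrE// ltW.
move=> /cvg_ex[/= u tu]; exists u.
(* [inner ^~ u] agrees with [phi] on the basis; the bounds on both then extend
   the equality from the dense span to the whole space. *)
have ue j : inner (e j) u = phi (e j).
  have lim1 : inner (e j) (series t n) @[n --> \oo] --> inner (e j) u.
    by apply: (cvg_comp _ _ tu); exact: (@inner_continuous _ _ (e j) u).
  have lim2 : inner (e j) (series t n) @[n --> \oo] --> phi (e j).
    apply: cvg_near_cst; exists j.+1 => // n /= jn.
    by rewrite seriesEnat/= innerC inner_comb ?iota_uniq// mem_index_iota /= jn.
  exact: (cvg_unique _ lim1 lim2).
move=> h; apply/eqP; rewrite -subr_eq0 -normr_eq0 eq_le normr_ge0 andbT.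
apply/ler_addgt0Pr => eps eps0; rewrite add0r.
have K0 : 0 <= K + `|u|.
  have [->|e0] := eqVneq u 0.
    rewrite normr0 addr0; have := phiK (e 0%N).
    have -> : `|e 0%N| = 1.
      by apply/eqP; rewrite -sqrp_eq1// -inner_norm e_on eqxx.
    by rewrite mulr1; apply: le_trans.
  rewrite addr_ge0//; have := phiK u; move=> /(le_trans (normr_ge0 _)).
  by rewrite pmulr_lge0// normr_gt0.
have K1 : 0 < K + `|u| + 1 by rewrite ltr_wpDl.
have [|n [c]] := @onb_approx h (eps / (K + `|u| + 1)); first by rewrite divr_gt0.
set s := \sum_(_ < _) _ => hs.
have ss : phi s = inner s u.
  rewrite /s -(big_mkord xpredT (fun i => c i *: e i)) phi_sum inner_suml.
  by apply: eq_bigr => i _; rewrite innerZl ue.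
have -> : phi h - inner h u = phi (h - s) - inner (h - s) u.
  by rewrite innerBl phiD -[- s]scaleN1r phiZ ss; ring.
rewrite (le_trans (ler_normB _ _))//.
rewrite (le_trans (lerD (phiK _) (Cauchy_Schwarz _ _)))//.
rewrite [X in _ + X]mulrC -mulrDl.
apply: (@le_trans _ _ ((K + `|u| + 1) * `|h - s|)).
  by rewrite ler_wpM2r// lerDl.
by rewrite -ler_pdivlMl// mulrC ltW.
Qed.

End orthonormal_basis.

(** * Adjoints and Hilbert-Schmidt norms *)

Section hilbert_schmidt_operators.
Context {R : realType} {U V : hilbertType R}.
Variables (e : nat -> U) (f : nat -> V).
Hypotheses (e_onb : orthonormal_basis e) (f_onb : orthonormal_basis f).

Lemma hs_sqnorm_ge0 (W : hilbertType R) (b : nat -> W) (A : W -> V) :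
  (0 <= hs_sqnorm b A)%E.
Proof. by apply: nneseries_ge0 => i _ _; rewrite lee_fin sqr_ge0. Qed.

Variable T : U -> V.
Hypothesis T_hs : hilbert_schmidt e T.

Let r : R := fine (hs_sqnorm e T).

Lemma hs_sqnorm_fin : hs_sqnorm e T = r%:E.
Proof.
have [_ _ T_fin] := T_hs.
by rewrite /r fineK// ge0_fin_numE// hs_sqnorm_ge0.
Qed.

Lemma fine_hs_sqnorm_ge0 : 0 <= r.
Proof. by rewrite fine_ge0// hs_sqnorm_ge0. Qed.

Lemma hs_bounded : exists K, forall x, `|T x| <= K * `|x|.
Proof.
have [lT cT _] := T_hs.
pose TL : {linear U -> V} := HB.pack T (GRing.isLinear.Build R U V _ T lT).
have : bounded_near TL (nbhs 0) by apply: continuous_linear_bounded; exact: cT.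
by move=> /linear_boundedP/pinfty_ex_gt0[K _ TK]; exists K.
Qed.

Lemma hs_linearD x y : T (x + y) = T x + T y.
Proof. by have [lT _ _] := T_hs; have := lT 1 x y; rewrite !scale1r. Qed.

Lemma adjointE h v : inner (T h) v = inner h (adjoint T v).
Proof.
have [lT _ _] := T_hs; have [K TK] := hs_bounded.
rewrite /adjoint; case: xgetP => [u _ /= -> //|none].
have [||u uE] := Riesz e_onb (phi := fun h => inner (T h) v) (K := K * `|v|).
- by move=> a x y; rewrite lT innerDl innerZl.
- move=> x; rewrite (le_trans (Cauchy_Schwarz _ _))// -mulrA (mulrC `|v|) mulrA.
  by rewrite ler_wpM2r.
- by have := none u.
Qed.

Lemma adjointD v w : adjoint T (v + w) = adjoint T v + adjoint T w.
Proof.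
apply/eqP; rewrite -subr_eq0 -normr_eq0 -sqrf_eq0; set d := _ - _.
by rewrite -inner_norm {2}/d innerBr innerDr -!adjointE innerDr subrr.
Qed.

(** This formula also makes the norm of an adjoint measurable in a parameter:
    its right-hand side is defined by choice, its left-hand side is explicit. *)
Lemma sqr_norm_adjoint v :
  (\sum_(0 <= i <oo) (inner v (T (e i)) ^+ 2)%:E = (`|adjoint T v| ^+ 2)%:E)%E.
Proof.
rewrite -(Parseval e_onb); apply: eq_eseriesr => i _.
by rewrite innerC adjointE innerC.
Qed.

Lemma sqr_norm_adjoint_le v : `|adjoint T v| ^+ 2 <= r * `|v| ^+ 2.
Proof.
rewrite -lee_fin -sqr_norm_adjoint mulrC EFinM -hs_sqnorm_fin.
rewrite /hs_sqnorm -nneseriesZl; last by move=> i _; rewrite lee_fin sqr_ge0.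
apply: lee_nneseries => [i _ _|i _]; first by rewrite lee_fin sqr_ge0.
rewrite -EFinM lee_fin -exprMn -[leLHS]real_normK ?num_real//.
by rewrite ler_sqr ?nnegrE ?mulr_ge0// Cauchy_Schwarz.
Qed.

(** Write [|T h|^2 = <h, T^* (T h)>] and apply the bound on the adjoint. *)
Lemma sqr_norm_hs_le h : `|T h| ^+ 2 <= r * `|h| ^+ 2.
Proof.
have [->|Th0] := eqVneq (`|T h| ^+ 2) 0.
  by rewrite mulr_ge0 ?sqr_ge0 ?fine_hs_sqnorm_ge0.
have Th_gt0 : 0 < `|T h| ^+ 2 by rewrite lt_def Th0 sqr_ge0.
have : (`|T h| ^+ 2) ^+ 2 <= r * `|h| ^+ 2 * `|T h| ^+ 2.
  rewrite -{1}inner_norm adjointE.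
  apply: (@le_trans _ _ ((`|h| * `|adjoint T (T h)|) ^+ 2)).
    rewrite -[leLHS]real_normK ?num_real// ler_sqr ?nnegrE ?mulr_ge0//.
    exact: Cauchy_Schwarz.
  rewrite exprMn (mulrC r) -[leRHS]mulrA ler_wpM2l ?sqr_ge0//.
  exact: sqr_norm_adjoint_le.
by rewrite expr2 ler_pM2r.
Qed.

Lemma norm_hs_le h : `|T h| <= Num.sqrt r * `|h|.
Proof.
rewrite -ler_sqr ?nnegrE ?mulr_ge0 ?sqrtr_ge0// exprMn sqr_sqrtr.
  exact: sqr_norm_hs_le.
exact: fine_hs_sqnorm_ge0.
Qed.

Lemma norm_adjoint_le v : `|adjoint T v| <= Num.sqrt r * `|v|.
Proof.
rewrite -ler_sqr ?nnegrE ?mulr_ge0 ?sqrtr_ge0// exprMn sqr_sqrtr.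
  exact: sqr_norm_adjoint_le.
exact: fine_hs_sqnorm_ge0.
Qed.

Lemma sqrt_hsM : Num.sqrt r * Num.sqrt r = r.
Proof. by rewrite -expr2 sqr_sqrtr// fine_hs_sqnorm_ge0. Qed.

Lemma norm_adjointT_le h : `|adjoint T (T h)| <= r * `|h|.
Proof.
rewrite (le_trans (norm_adjoint_le _))// -[in leRHS]sqrt_hsM -mulrA.
by rewrite ler_wpM2l ?sqrtr_ge0// norm_hs_le.
Qed.

Lemma norm_Tadjoint_le v : `|T (adjoint T v)| <= r * `|v|.
Proof.
rewrite (le_trans (norm_hs_le _))// -[in leRHS]sqrt_hsM -mulrA.
by rewrite ler_wpM2l ?sqrtr_ge0// norm_adjoint_le.
Qed.

(** Both sides are the sum of the squared matrix entries [<T e_i, f_j>]. *)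
Lemma hs_sqnorm_adjoint : hs_sqnorm f (adjoint T) = hs_sqnorm e T.
Proof.
rewrite /hs_sqnorm; under eq_eseriesr do rewrite -sqr_norm_adjoint.
rewrite nneseries_interchange; last by move=> i j; rewrite lee_fin sqr_ge0.
apply: eq_eseriesr => i _; rewrite -(Parseval f_onb).
by apply: eq_eseriesr => j _; rewrite innerC.
Qed.

Lemma hs_sqnorm_adjointT_le :
  (hs_sqnorm e (fun h => adjoint T (T h)) <= (r ^+ 2)%:E)%E.
Proof.
rewrite expr2 EFinM -{2}hs_sqnorm_fin /hs_sqnorm -nneseriesZl; last first.
  by move=> i _; rewrite lee_fin sqr_ge0.
apply: lee_nneseries => [i _ _|i _]; first by rewrite lee_fin sqr_ge0.
by rewrite -EFinM lee_fin sqr_norm_adjoint_le.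
Qed.

Lemma hs_sqnorm_Tadjoint_le :
  (hs_sqnorm f (fun v => T (adjoint T v)) <= (r ^+ 2)%:E)%E.
Proof.
rewrite expr2 EFinM -{2}hs_sqnorm_fin -hs_sqnorm_adjoint.
rewrite /hs_sqnorm -nneseriesZl; last first.
  by move=> i _; rewrite lee_fin sqr_ge0.
apply: lee_nneseries => [i _ _|i _]; first by rewrite lee_fin sqr_ge0.
by rewrite -EFinM lee_fin sqr_norm_hs_le.
Qed.

End hilbert_schmidt_operators.

(** * Variance of empirical means *)

Section square_integrable.
Context d (T : measurableType d) (R : realType) (mu : probability T R).

(** On a probability space [|a| <= a^2 + 1] is integrable. *)
Lemma integrable_from_sqr (a : T -> R) :
  measurable_fun setT a -> mu.-integrable setT (fun t => (a t ^+ 2)%:E) ->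
  mu.-integrable setT (EFin \o a).
Proof.
move=> ma ia2; have i1 := finite_measure_integrable_cst mu 1 measurableT.
apply: le_integrable (integrableD measurableT ia2 i1) => //.
  exact/measurable_EFinP.
move=> t _; rewrite lee_fin/= [leRHS]ger0_norm; last by rewrite addr_ge0// sqr_ge0.
have := sqr_ge0 (`|a t| - 1); rewrite sqrrB real_normK ?num_real// expr1n mulr1.
have := normr_ge0 (a t); lra.
Qed.

Lemma integrable_product (a b : T -> R) :
  measurable_fun setT a -> measurable_fun setT b ->
  mu.-integrable setT (fun t => (a t ^+ 2)%:E) ->
  mu.-integrable setT (fun t => (b t ^+ 2)%:E) ->
  mu.-integrable setT (fun t => (a t * b t)%:E).
Proof.
move=> ma mb ia ib.
apply: le_integrable (integrableD measurableT ia ib) => //.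
  by apply/measurable_EFinP; exact: measurable_funM.
move=> t _; rewrite lee_fin/= normrM [leRHS]ger0_norm; last first.
  by rewrite addr_ge0// sqr_ge0.
have := sqr_ge0 (`|a t| - `|b t|).
rewrite sqrrB !real_normK ?num_real//.
have := sqr_ge0 (a t); have := sqr_ge0 (b t).
set u := `|a t| * `|b t|; lra.
Qed.

Variable a : T -> R.
Hypothesis ma : measurable_fun setT a.
Hypothesis ia2 : mu.-integrable setT (fun t => (a t ^+ 2)%:E).

Let m : R := fine (\int[mu]_t (a t)%:E).

Let mE : (\int[mu]_t (a t)%:E)%E = m%:E.
Proof. by rewrite fineK// integrable_fin_num//; exact: integrable_from_sqr. Qed.

Let ia := integrable_from_sqr ma ia2.

Lemma centered_sqrE t : ((a t - m) ^+ 2)%:E =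
  ((a t ^+ 2)%:E - ((2 * m)%:E * (a t)%:E - (m ^+ 2)%:E))%E.
Proof. by rewrite -EFinM -EFinB; congr EFin; ring. Qed.

Let im2 := finite_measure_integrable_cst mu (m ^+ 2) measurableT.

Lemma integrable_centered_sqr :
  mu.-integrable setT (fun t => ((a t - m) ^+ 2)%:E).
Proof.
rewrite (eq_fun centered_sqrE); apply: integrableB => //.
by apply: integrableB => //; exact: integrableZl.
Qed.

Lemma integral_centered : (\int[mu]_t (a t - m)%:E = 0)%E.
Proof.
under eq_integral do rewrite EFinB.
rewrite integralB_EFin//; last exact: finite_measure_integrable_cst.
by rewrite mE (integral_cst mu measurableT m%:E)/= probability_setT mule1 subee.
Qed.

Lemma integral_centered_sqr_le :
  (\int[mu]_t ((a t - m) ^+ 2)%:E <= \int[mu]_t (a t ^+ 2)%:E)%E.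
Proof.
under eq_integral do rewrite centered_sqrE.
rewrite integralB//; last by apply: integrableB => //; exact: integrableZl.
rewrite integralB//; last exact: integrableZl.
rewrite integralZl// mE (integral_cst mu measurableT (m ^+ 2)%:E)/=.
rewrite probability_setT mule1 -EFinM -EFinB.
rewrite leeBlDr// leeDl// lee_fin.
have -> : 2 * m * m - m ^+ 2 = m ^+ 2 by ring.
exact: sqr_ge0.
Qed.

End square_integrable.

Section empirical_mean.
Context d' (T : measurableType d') (R : realType) (mu : probability T R).
Context d (Om : measurableType d) (P : probability Om R).
Variables (N : nat) (x : 'I_N -> Om -> T).
Hypothesis x_iid : iid_samples P mu x.

Lemma measurable_sample k : measurable_fun setT (x k).
Proof. by have [] := x_iid. Qed.

Lemma sample_integral k (phi : T -> \bar R) :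
  measurable_fun setT phi -> (forall t, (0 <= phi t)%E) ->
  (\int[P]_om phi (x k om) = \int[mu]_t phi t)%E.
Proof.
move=> mphi phi0.
pose X : {mfun Om >-> T} := HB.pack (x k)
  (isMeasurableFun.Build _ _ _ _ (x k) (measurable_sample k)).
have -> : (\int[P]_om phi (x k om) = \int[P]_om (phi \o X) om)%E by [].
rewrite -(ge0_integral_distribution (P := P) X)//.
apply: eq_measure_integral => A mA _.
by have [_ + _] := x_iid; apply.
Qed.

Lemma sample_pair k l (A B : set T) : k != l -> measurable A -> measurable B ->
  (P ((x k @^-1` A) `&` (x l @^-1` B)) = mu A * mu B)%E.
Proof.
move=> kl mA mB; have [_ xmu xind] := x_iid.
(* The product rule is stated over all indices: the remaining ones get [setT]. *)
pose D i := if i == k then A else if i == l then B else setT.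
have lk : (l == k) = false by rewrite eq_sym (negbTE kl).
have mD i : measurable (D i) by rewrite /D; do 2?[case: ifP => // _].
have := xind D mD.
have -> : \bigcap_i (x i @^-1` D i) = (x k @^-1` A) `&` (x l @^-1` B).
  apply/seteqP; split => [om h|om [hA hB] i _ /=].
    by split; [have := h k I|have := h l I]; rewrite /= /D ?eqxx ?lk.
  by rewrite /D; case: eqP => [->//|_]; case: eqP => [->|].
move=> ->; rewrite (bigD1 k)//= (bigD1 l)//=; last by rewrite eq_sym.
rewrite big1 ?mule1; last first.
  by move=> i /andP[/negbTE ik /negbTE il]; rewrite /D ik il xmu// probability_setT.
by rewrite !xmu// /D eqxx lk eqxx.
Qed.

(** The pair [(x k, x l)] has law [mu \x mu], so that Fubini's theorem factors
    the integral. *)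
Lemma sample_uncorrelated k l (c : T -> R) : k != l ->
  measurable_fun setT c -> mu.-integrable setT (fun t => (c t ^+ 2)%:E) ->
  (\int[mu]_t (c t)%:E = 0)%E ->
  P.-integrable setT (fun om => (c (x k om) * c (x l om))%:E) ->
  (\int[P]_om (c (x k om) * c (x l om))%:E = 0)%E.
Proof.
move=> kl mc ic2 c0 icc; have ic := integrable_from_sqr mc ic2.
pose X : Om -> T * T := fun om => (x k om, x l om).
have mX : measurable_fun setT X.
  by apply: measurable_fun_pair; exact: measurable_sample.
pose XM : {mfun Om >-> (T * T)%type} := HB.pack X
  (isMeasurableFun.Build _ _ _ _ X mX).
pose f (p : T * T) := (c p.1 * c p.2)%:E.
have mf : measurable_fun setT f.
  apply/measurable_EFinP; apply: measurable_funM.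
    exact: measurableT_comp mc measurable_fst.
  exact: measurableT_comp mc measurable_snd.
have law A : measurable A -> (mu \x mu)%E A = distribution P XM A.
  apply: (product_measure_unique (m' := distribution P XM)) => B C mB mC.
  by rewrite -(sample_pair kl).
have -> : (\int[P]_om (c (x k om) * c (x l om))%:E =
    \int[P]_om (f \o XM) om)%E by [].
rewrite -(integral_distribution (P := P) (X := XM) mf)//.
rewrite -(@eq_measure_integral _ _ _ _ _ (mu \x mu)%E); last first.
  by move=> A mA _; exact: law.
rewrite -integral12_prod_meas1.
  rewrite /fubini_F; under eq_integral do rewrite /f/=.
  rewrite integral0_eq// => s _; under eq_integral do rewrite EFinM.
  by rewrite integralZl// c0 mule0.
apply/integrable12ltyP => //.
have /integrableP[mc' icy] := ic.
have mnc : measurable_fun setT (fun t => `|(c t)%:E|)%E.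
  exact: measurableT_comp mc'.
have h s : (\int[mu]_t `|f (s, t)| = `|(c s)%:E| * \int[mu]_t `|(c t)%:E|)%E.
  have fE t : f (s, t) = ((c s)%:E * (c t)%:E)%E by rewrite /f EFinM.
  by under eq_integral do rewrite fE abseM; rewrite ge0_integralZl.
under eq_integral do rewrite h muleC.
rewrite ge0_integralZl//; last exact: integral_ge0.
by rewrite lte_mul_pinfty// ?integral_ge0// ge0_fin_numE// integral_ge0.
Qed.

Variable a : T -> R.
Hypothesis ma : measurable_fun setT a.
Hypothesis ia2 : mu.-integrable setT (fun t => (a t ^+ 2)%:E).

Let m : R := fine (\int[mu]_t (a t)%:E).
Let c t := a t - m.

(** Expanding the square, the off-diagonal covariances vanish by independence;
    only the [N] diagonal variances remain. *)
Lemma empirical_mean_variance : (0 < N)%N ->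
  (\int[P]_om ((m - N%:R^-1 * \sum_(k < N) a (x k om)) ^+ 2)%:E
     <= (N%:R^-1)%:E * \int[mu]_t (a t ^+ 2)%:E)%E.
Proof.
move=> N0; have NR : N%:R != 0 :> R by rewrite pnatr_eq0 -lt0n.
have mc : measurable_fun setT c by apply: measurable_funB.
have ic2 : mu.-integrable setT (fun t => (c t ^+ 2)%:E).
  exact: integrable_centered_sqr.
have mcx k : measurable_fun setT (c \o x k).
  by apply: measurableT_comp => //; exact: measurable_sample.
have mc2 : measurable_fun setT (fun t => (c t ^+ 2)%:E).
  by apply/measurable_EFinP; exact: measurable_funX.
have ic2x k : P.-integrable setT (fun om => (c (x k om) ^+ 2)%:E).
  apply/integrableP; split.
    by apply/measurable_EFinP; apply: measurable_funX; exact: mcx.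
  under eq_integral do rewrite /= ger0_norm ?sqr_ge0//.
  rewrite (sample_integral k mc2); last by move=> t; rewrite lee_fin sqr_ge0.
  exact: integrable_lty.
have icc k l : P.-integrable setT (fun om => (c (x k om) * c (x l om))%:E).
  exact: (integrable_product (mcx k) (mcx l) (ic2x k) (ic2x l)).
have -> : (\int[P]_om ((m - N%:R^-1 * \sum_(k < N) a (x k om)) ^+ 2)%:E =
    \int[P]_om ((N%:R^-1 ^+ 2)%:E *
       \sum_(p : 'I_N * 'I_N) (c (x p.1 om) * c (x p.2 om))%:E))%E.
  apply: eq_integral => om _; rewrite sumEFin -EFinM; congr EFin.
  have -> : m - N%:R^-1 * \sum_(k < N) a (x k om) =
      - (N%:R^-1 * \sum_(k < N) c (x k om)).
    rewrite /c big_split/= sumr_const card_ord -[- m *+ N]mulr_natl; field; exact: NR.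
  by rewrite sqrrN exprMn; congr (_ * _); rewrite expr2 big_distrlr/= pair_big.
rewrite integralZl//; last by apply: integrable_sum => // p _; exact: icc.
rewrite integral_sum//.
have -> : (\sum_(p : 'I_N * 'I_N) \int[P]_om (c (x p.1 om) * c (x p.2 om))%:E =
    \sum_(k < N) \int[mu]_t (c t ^+ 2)%:E)%E.
  rewrite -(pair_big xpredT xpredT (fun k l =>
    (\int[P]_om (c (x k om) * c (x l om))%:E)%E))/=.
  apply: eq_bigr => k _; rewrite (bigD1 k)//= big1 ?adde0.
    rewrite -(sample_integral k mc2); last by move=> t; rewrite lee_fin sqr_ge0.
    by apply: eq_integral => om _; rewrite expr2.
  move=> l lk; apply: sample_uncorrelated => //; first by rewrite eq_sym.
  exact: integral_centered.
have /fineK <- : (\int[mu]_t (c t ^+ 2)%:E)%E \is a fin_num.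
  exact: integrable_fin_num.
have /fineK <- : (\int[mu]_t (a t ^+ 2)%:E)%E \is a fin_num.
  exact: integrable_fin_num.
rewrite sumEFin sumr_const card_ord -!EFinM lee_fin.
rewrite -[fine _ *+ N]mulr_natl expr2 -mulrA mulKf// ler_wpM2l//.
apply: fine_le; [exact: integrable_fin_num..|].
exact: integral_centered_sqr_le.
Qed.

End empirical_mean.

(** * Monte Carlo error of a random operator *)

Section random_operator.
Context d' (T : measurableType d') (R : realType) (mu : probability T R).
Variables (U : hilbertType R) (e : nat -> U).
Hypothesis e_onb : orthonormal_basis e.
Variables (A : T -> U -> U) (g : T -> R).
Hypothesis mA : forall h k, measurable_fun setT (fun t => inner (A t h) k).
Hypothesis mg : measurable_fun setT g.
Hypothesis A_le : forall t h, `|A t h| <= g t * `|h|.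
Hypothesis ig2 : mu.-integrable setT (fun t => (g t ^+ 2)%:E).

Lemma entry_le t h k : `|inner (A t h) k| <= g t * (`|h| * `|k|).
Proof.
by rewrite (le_trans (Cauchy_Schwarz _ _))// mulrA ler_wpM2r.
Qed.

Lemma integrable_entry h k :
  mu.-integrable setT (fun t => (inner (A t h) k)%:E).
Proof.
have ig := integrable_from_sqr mg ig2.
apply: le_integrable (integrableZl measurableT (`|h| * `|k|) ig) => //.
  by apply/measurable_EFinP; exact: mA.
move=> t _; rewrite -EFinM lee_fin.
rewrite (le_trans (entry_le _ _ _))// mulrC ler_norm//.
Qed.

Lemma integrable_entry_sqr h k :
  mu.-integrable setT (fun t => (inner (A t h) k ^+ 2)%:E).
Proof.
apply: le_integrable (integrableZl measurableT ((`|h| * `|k|) ^+ 2) ig2) => //.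
  by apply/measurable_EFinP; apply: measurable_funX; exact: mA.
move=> t _; rewrite -EFinM lee_fin -exprMn !normrX ler_pXn2r ?nnegrE//.
by rewrite (le_trans (entry_le _ _ _))// mulrC ler_norm.
Qed.

(** The form [k |-> E <A h, k>] is bounded by [E g * |h|], so the weak
    expectation exists by the Riesz representation theorem. *)
Lemma op_expectationE h k :
  inner (op_expectation mu A h) k = fine (\int[mu]_t (inner (A t h) k)%:E).
Proof.
rewrite /op_expectation; case: xgetP => [m _ /= /(_ k)[_ <-]//|none].
have ig := integrable_from_sqr mg ig2.
pose psi k := fine (\int[mu]_t (inner (A t h) k)%:E).
have psiE k' : (psi k')%:E = (\int[mu]_t (inner (A t h) k')%:E)%E.
  by rewrite fineK// integrable_fin_num//; exact: integrable_entry.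
pose G := fine (\int[mu]_t (g t)%:E).
have GE : G%:E = (\int[mu]_t (g t)%:E)%E.
  by rewrite fineK// integrable_fin_num.
have [||u uE] := Riesz e_onb (phi := psi) (K := G * `|h|).
- move=> c y z; apply: EFin_inj; rewrite EFinD EFinM !psiE.
  rewrite -integralZl//; last exact: integrable_entry.
  rewrite -integralD//; last 2 first.
  + by apply: integrableZl => //; exact: integrable_entry.
  + exact: integrable_entry.
  by apply: eq_integral => t _; rewrite innerDr innerZr.
- move=> y; rewrite -lee_fin -abse_EFin psiE.
  apply: le_trans (le_abse_integral _ _ _) _ => //.
    by have /integrableP[] := integrable_entry h y.
  rewrite -mulrA (mulrC G) EFinM GE -integralZl//.
  apply: le_integral => //.
  - by apply: integrable_abse; exact: integrable_entry.
  - exact: integrableZl.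
  by move=> t _; rewrite -EFinM lee_fin (le_trans (entry_le _ _ _))// mulrC.
have [] := none u; move=> k'; split; first exact: integrable_entry.
by rewrite -psiE uE innerC.
Qed.

Hypothesis A_hs : forall t, (hs_sqnorm e (A t) <= (g t ^+ 2)%:E)%E.

(** By Parseval's identity the squared Hilbert-Schmidt norm is the sum of the
    squared matrix entries, each of which is the squared error of an empirical
    mean; summing the scalar variance bounds reassembles [hs_sqnorm e (A t)]. *)
Lemma random_operator_error d (Om : measurableType d) (P : probability Om R)
    (N : nat) (x : 'I_N -> Om -> T) : (0 < N)%N -> iid_samples P mu x ->
  (\int[P]_om hs_sqnorm e (op_expectation mu A \-
       (fun h => N%:R^-1 *: \sum_(k < N) A (x k om) h))%R
    <= (N%:R^-1)%:E * \int[mu]_t (g t ^+ 2)%:E)%E.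
Proof.
move=> N0 x_iid.
pose a i j t := inner (A t (e i)) (e j).
pose q i j om := ((fine (\int[mu]_t (a i j t)%:E)
  - N%:R^-1 * \sum_(k < N) a i j (x k om)) ^+ 2)%:E.
have q0 i j om : (0 <= q i j om)%E by rewrite lee_fin sqr_ge0.
have mq i j : measurable_fun setT (q i j).
  apply/measurable_EFinP/measurable_funX/measurable_funB => //.
  apply: measurable_funM => //; apply: measurable_sum => k.
  exact: (measurableT_comp (mA _ _) (measurable_sample x_iid k)).
have -> : (\int[P]_om hs_sqnorm e (op_expectation mu A \-
       (fun h => N%:R^-1 *: \sum_(k < N) A (x k om) h))%R =
    \int[P]_om \sum_(0 <= i <oo) \sum_(0 <= j <oo) q i j om)%E.
  apply: eq_integral => om _; apply: eq_eseriesr => i _.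
  rewrite -(Parseval e_onb); apply: eq_eseriesr => j _.
  by rewrite /q innerBl innerZl inner_suml op_expectationE.
rewrite integral_nneseries//; last 2 first.
- move=> i; apply: ge0_emeasurable_sum => //.
- by move=> i om _; apply: nneseries_ge0.
apply: (@le_trans _ _ ((N%:R^-1)%:E *
    \sum_(0 <= i <oo) \sum_(0 <= j <oo) \int[mu]_t (a i j t ^+ 2)%:E)%E).
  rewrite -nneseriesZl; last first.
    move=> i _; apply: nneseries_ge0 => j _ _.
    by apply: integral_ge0 => t _; rewrite lee_fin sqr_ge0.
  apply: lee_nneseries => [i _ _|i _].
    by apply: integral_ge0 => om _; apply: nneseries_ge0.
  rewrite integral_nneseries// -nneseriesZl; last first.
    by move=> j _; apply: integral_ge0 => t _; rewrite lee_fin sqr_ge0.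
  apply: lee_nneseries => [j _ _|j _]; first exact: integral_ge0.
  apply: empirical_mean_variance => //; [exact: mA|exact: integrable_entry_sqr].
rewrite lee_wpmul2l ?lee_fin ?invr_ge0//.
have ma2 i j : measurable_fun setT (fun t => (a i j t ^+ 2)%:E).
  by apply/measurable_EFinP; apply: measurable_funX; exact: mA.
have a20 i j t : (0 <= (a i j t ^+ 2)%:E)%E by rewrite lee_fin sqr_ge0.
under eq_eseriesr do rewrite -integral_nneseries//.
rewrite -integral_nneseries//; last 2 first.
- by move=> i; apply: ge0_emeasurable_sum.
- by move=> i t _; apply: nneseries_ge0.
apply: ge0_le_integral => //.
- by move=> t _; apply: nneseries_ge0 => i _ _; apply: nneseries_ge0.
- apply: ge0_emeasurable_sum => [i t _ _|i _]; first exact: nneseries_ge0.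
  exact: ge0_emeasurable_sum.
- by apply/measurable_EFinP; exact: measurable_funX.
move=> t _; apply: le_trans (A_hs t).
by rewrite /hs_sqnorm; under [leRHS]eq_eseriesr do rewrite -(Parseval e_onb).
Qed.

End random_operator.

(** * The derivative of a Sobolev function *)

Section borel_measurability.
Context (R : realType) (Y : hilbertType R).

Lemma continuous_borel_measurable (phi : Y -> R) : continuous phi ->
  measurable_fun setT (phi : borel Y -> R).
Proof.
move=> /continuousP cphi; apply: (measurability _ (RGenOpens.measurableE R)).
move=> _ [_ [a [b ->]] <-]; rewrite setTI; apply: sub_sigma_algebra.
exact/cphi/interval_open.
Qed.

Context d (T : measurableType d) (E : hilbertType R) (DF : T -> E -> Y).
Variable (e : nat -> E).
Hypothesis e_onb : orthonormal_basis e.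
Hypothesis DF_hs : forall x, hilbert_schmidt e (DF x).
Hypothesis mDF : forall w, measurable_fun setT ((fun x => DF x w) : T -> borel Y).

Lemma measurable_sqr_norm_DF w : measurable_fun setT (fun x => `|DF x w| ^+ 2).
Proof.
have := continuous_borel_measurable (@sqr_norm_continuous _ Y).
by move=> /measurableT_comp; apply; exact: mDF.
Qed.

Lemma measurable_inner_DF y w : measurable_fun setT (fun x => inner y (DF x w)).
Proof.
have := continuous_borel_measurable (@inner_continuous _ Y y).
by move=> /measurableT_comp; apply; exact: mDF.
Qed.

Lemma measurable_hs_DF : measurable_fun setT (fun x => hs_sqnorm e (DF x)).
Proof.
apply: ge0_emeasurable_sum => [i x _ _|i _]; first by rewrite lee_fin sqr_ge0.
by apply/measurable_EFinP; exact: measurable_sqr_norm_DF.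
Qed.

Lemma measurable_fine_hs_DF :
  measurable_fun setT (fun x => fine (hs_sqnorm e (DF x))).
Proof.
exact: (measurableT_comp (fine_measurable measurableT) measurable_hs_DF).
Qed.

Lemma measurable_sqr_norm_adjoint v :
  measurable_fun setT (fun x => `|adjoint (DF x) v| ^+ 2).
Proof.
apply/measurable_EFinP; rewrite /comp.
under eq_fun do rewrite -(sqr_norm_adjoint e_onb (DF_hs _)).
apply: ge0_emeasurable_sum => [i x _ _|i _]; first by rewrite lee_fin sqr_ge0.
by apply/measurable_EFinP/measurable_funX; exact: measurable_inner_DF.
Qed.

(** Both kinds of entries are inner products of vectors depending linearly on
    fixed ones, so polarization reduces their measurability to that of squared
    norms. *)
Lemma measurable_adjointDF h k :
  measurable_fun setT (fun x => inner (adjoint (DF x) (DF x h)) k).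
Proof.
under eq_fun do rewrite innerC -(adjointE e_onb (DF_hs _)) inner_polarization
  -(hs_linearD (DF_hs _)).
apply: measurable_funM => //.
by do 2?[apply: measurable_funB]; exact: measurable_sqr_norm_DF.
Qed.

Lemma measurable_DFadjoint v w :
  measurable_fun setT (fun x => inner (DF x (adjoint (DF x) v)) w).
Proof.
under eq_fun do rewrite (adjointE e_onb (DF_hs _)) inner_polarization
  -(adjointD e_onb (DF_hs _)).
apply: measurable_funM => //.
by do 2?[apply: measurable_funB]; exact: measurable_sqr_norm_adjoint.
Qed.

End borel_measurability.

Section cylindrical_derivative.
Context (R : realType) (X Y : hilbertType R)
  (C : covariance_op X) (S : sqrt_cov C).
Variable (e : nat -> cameron_martin S).
Hypothesis e_on : forall i j, inner (e i) (e j) = (i == j)%:R.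

(** On the Cameron-Martin space [<a, w>_X = <S a, S^-1 w>_X], and the [S^-1 e_i]
    are orthonormal in [X]: by Bessel's inequality their squared inner products with
    [S a] sum to at most [|S a|^2]. *)
Lemma hs_sqnorm_linear_form (a : X) (c : R) (y : Y) :
  (hs_sqnorm e (fun w => (c * inner a (\val w)) *: y)
    <= ((c * `|S a| * `|y|) ^+ 2)%:E)%E.
Proof.
pose v i := cov_root_inv (e i).
have v_on i j : inner (v i) (v j) = (i == j)%:R by rewrite -e_on.
have aE i : inner a (\val (e i)) = inner (S a) (v i).
  by rewrite -cov_root_invK cov_root_sym.
have -> : (c * `|S a| * `|y|) ^+ 2 = (c * `|y|) ^+ 2 * `|S a| ^+ 2 by ring.
rewrite EFinM.
apply: (@le_trans _ _ (((c * `|y|) ^+ 2)%:E *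
  \sum_(0 <= i <oo) (inner (S a) (v i) ^+ 2)%:E)%E); last first.
  by rewrite lee_wpmul2l ?lee_fin ?sqr_ge0//; exact: Bessel_series.
rewrite -nneseriesZl; last by move=> i _; rewrite lee_fin sqr_ge0.
apply: lee_nneseries => [i _ _|i _]; first by rewrite lee_fin sqr_ge0.
rewrite -EFinM lee_fin sqr_normZ aE le_eqVlt; apply/orP; left; apply/eqP; ring.
Qed.

Lemma hs_sqnormD (D1 D2 : cameron_martin S -> Y) :
  (hs_sqnorm e (D1 \+ D2)%R <= 2%:E * hs_sqnorm e D1 + 2%:E * hs_sqnorm e D2)%E.
Proof.
have sq0 (v : Y) : (0 <= (`|v| ^+ 2)%:E :> \bar R)%E by rewrite lee_fin sqr_ge0.
have sq20 (v : Y) : (0 <= 2%:E * (`|v| ^+ 2)%:E :> \bar R)%E by rewrite mule_ge0.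
rewrite /hs_sqnorm -!nneseriesZl// -nneseriesD//.
apply: lee_nneseries => // i _.
by rewrite -!EFinM -EFinD lee_fin sqr_normD_le.
Qed.

Lemma bounded_hs_sum (I : Type) (s : seq I) (t : I -> X -> cameron_martin S -> Y) :
  (forall i, exists K : R, forall x, (hs_sqnorm e (t i x) <= K%:E)%E) ->
  exists K : R, forall x, (hs_sqnorm e (fun w => \sum_(i <- s) t i x w)%R <= K%:E)%E.
Proof.
move=> tK; elim: s => [|i s [K sK]].
  exists 0 => x; rewrite /hs_sqnorm eseries0// => i _ _.
  by rewrite big_nil normr0 expr0n.
have [K' iK] := tK i; exists (2 * K' + 2 * K) => x.
have -> : (fun w => \sum_(j <- i :: s) t j x w)
    = (t i x \+ (fun w => \sum_(j <- s) t j x w))%R.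
  by apply/funext => w; rewrite big_cons.
apply: (le_trans (hs_sqnormD _ _)).
have -> : (2 * K' + 2 * K)%:E = (2%:E * K'%:E + 2%:E * K%:E)%E by [].
by rewrite leeD// lee_wpmul2l.
Qed.

Lemma is_diff_sum (V W : normedModType R) (I : Type) (s : seq I)
    (f df : I -> V -> W) x : (forall i, is_diff x (f i) (df i)) ->
  is_diff x (\sum_(i <- s) f i) (\sum_(i <- s) df i).
Proof.
move=> fdf; elim: s => [|i s ih]; first by rewrite !big_nil; exact: is_diff_cst.
by rewrite !big_cons; exact: is_diffD.
Qed.

Lemma row_inner_linear n (a : 'I_n -> X) :
  linear (fun x : X => \row_j inner (a j) x).
Proof. by move=> c u v; apply/rowP => j; rewrite !mxE innerDr innerZr. Qed.

Lemma row_inner_continuous n (a : 'I_n -> X) :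
  continuous (fun x : X => \row_j inner (a j) x).
Proof.
have -> : (fun x : X => \row_j inner (a j) x) =
    (fun x => \sum_(j < n) inner (a j) x *: (delta_mx 0 j : 'rV[R]_n)).
  apply/funext => x; rewrite [LHS]row_sum_delta.
  by apply: eq_bigr => j _; rewrite mxE.
move=> x; apply: cvg_big => [|j _]; first exact: add_continuous.
exact: (cvg_comp _ _ (@inner_continuous _ _ (a j) x) (@scalel_continuous _ _ _ _)).
Qed.

Lemma cm_diff_cylindrical n M (a : 'I_n -> X) (y : 'I_M -> Y)
    (phi : 'I_M -> 'rV[R]_n -> R) : (forall i p, differentiable (phi i) p) ->
  forall x (w : cameron_martin S),
  cm_diff (fun x => \sum_(i < M) phi i (\row_j inner (a j) x) *: y i) x w =
  \sum_(i < M) \sum_(j < n)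
    ('D_(delta_mx 0 j) (phi i) (\row_j inner (a j) x) * inner (a j) (\val w)) *: y i.
Proof.
move=> dphi x w; rewrite /cm_diff.
pose L : {linear X -> 'rV[R]_n} := HB.pack (fun x : X => \row_j inner (a j) x)
  (GRing.isLinear.Build R X 'rV[R]_n _ _ (row_inner_linear a)).
have Lc : continuous L by exact: row_inner_continuous.
have dL : is_diff x L L.
  by apply: DiffDef; [exact: linear_differentiable|rewrite diff_lin].
have dphiL i : is_diff x (phi i \o L) ('d (phi i) (L x) \o L).
  by apply: is_diff_comp; apply: differentiableP; exact: dphi.
have dt i : is_diff x ((fun c : R => c *: y i) \o (phi i \o L))
    ((fun c : R => c *: y i) \o ('d (phi i) (L x) \o L)).
  by apply: is_diff_comp; exact: is_diff_scalel.
have := is_diff_sum (index_enum 'I_M) dt.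
set Gs := \sum_(i <- _) _ => dG.
have -> : (fun x => \sum_(i < M) phi i (\row_j inner (a j) x) *: y i) = Gs.
  by apply/funext => z; rewrite /Gs fct_sumE.
rewrite diff_val fct_sumE; apply: eq_bigr => i _ /=.
rewrite -scaler_suml; congr (_ *: _).
rewrite [X in 'd _ _ X]row_sum_delta linear_sum; apply: eq_bigr => j _.
by rewrite linearZ/= mxE deriveE//= mulrC.
Qed.

(** Only finitely many linear forms [<a_j, .>] occur, each restricting to a
    Hilbert-Schmidt form on the Cameron-Martin space, with coefficients that are
    bounded because the first partial derivatives are. *)
Lemma cylindrical_bounded_hs (G : X -> Y) : cylindrical G ->
  exists K : R, forall x, (hs_sqnorm e (cm_diff (S := S) G x) <= K%:E)%E.
Proof.
move=> [n [M [a [y [phi [phiC ->]]]]]].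
have dphi i p : differentiable (phi i) p by have [+ _] := phiC i [::]; apply.
pose t i j x (w : cameron_martin S) :=
  ('D_(delta_mx 0 j) (phi i) (\row_j inner (a j) x) * inner (a j) (\val w)) *: y i.
have tK i j : exists K : R, forall x, (hs_sqnorm e (t i j x) <= K%:E)%E.
  have [_ [c dc]] := phiC i [:: j].
  exists ((c * `|S (a j)| * `|y i|) ^+ 2) => x.
  apply: (le_trans (hs_sqnorm_linear_form _ _ _)).
  rewrite lee_fin !exprMn !ler_wpM2r ?sqr_ge0//.
  rewrite -[leLHS]real_normK ?num_real// -[leRHS]real_normK ?num_real//.
  rewrite ler_sqr ?nnegrE// (le_trans (dc _))// ler_norm//.
have [K KP] := bounded_hs_sum (index_enum 'I_M)
  (fun i => bounded_hs_sum (index_enum 'I_n) (tK i)).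
exists K => x; have := KP x; congr (hs_sqnorm e _ <= _)%E.
by apply/funext => w; rewrite cm_diff_cylindrical.
Qed.

End cylindrical_derivative.

(** The integral of a nonnegative function is a supremum over the simple
    functions below it, and that supremum is monotone for arbitrary functions. *)
Lemma ge0_le_integral_nonmeasurable d (T : measurableType d) (R : realType)
    (mu : {measure set T -> \bar R}) (f1 f2 : T -> \bar R) :
  (forall x, 0 <= f1 x)%E -> (forall x, f1 x <= f2 x)%E ->
  (\int[mu]_x f1 x <= \int[mu]_x f2 x)%E.
Proof.
move=> f10 f12; have f20 x : (0 <= f2 x)%E by exact: le_trans (f12 x).
rewrite !ge0_integralTE//; apply: le_ereal_sup => _ [h hf1 <-].
by exists h => // x; exact: le_trans (hf1 x) (f12 x).
Qed.

Section fourth_moment.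
Context (R : realType) (X Y : hilbertType R)
  (C : covariance_op X) (S : sqrt_cov C).
Variables (gamma : probability (borel X) R) (e : nat -> cameron_martin S).
Hypothesis e_onb : orthonormal_basis e.
Variables (F : X -> Y) (DF : X -> cameron_martin S -> Y).
Hypothesis F_W14 : sobolev14 gamma e F DF.

Let r x := fine (hs_sqnorm e (DF x)).

(** Let [G n] be a cylindrical function at finite distance from [F], and [K] a
    bound on the squared Hilbert-Schmidt norms of its derivative.  If [q] is the
    squared Hilbert-Schmidt norm of the difference of the two derivatives, then
    [q^2] has finite integral and [r <= 2 q + 2 K]. *)
Lemma sobolev14_fourth_moment :
  gamma.-integrable setT (fun x => (r x ^+ 2)%:E).
Proof.
have [_ DF_hs mDF [G [Gcyl Gcvg]]] := F_W14.
have mr : measurable_fun setT (r : borel X -> R).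
  exact: (@measurable_fine_hs_DF _ _ _ (borel X) _ DF e mDF).
have /fine_cvgP[[n _ /(_ n (leqnn n))/= Gfin] _] := Gcvg.
pose q x := hs_sqnorm e (fun w => DF x w - cm_diff (G n) x w).
have q0 x : (0 <= q x)%E by exact: hs_sqnorm_ge0.
have q2fin : (\int[gamma]_x (q x ^+ 2) < +oo)%E.
  move: Gfin; rewrite /sobolev_norm4 fin_numElt => /andP[_].
  apply: le_lt_trans; rewrite leeDr//; apply: integral_ge0 => x _.
  by rewrite lee_fin exprn_ge0.
have [K GK] := cylindrical_bounded_hs (proj1 e_onb) (Gcyl n).
have rE x : hs_sqnorm e (DF x) = (r x)%:E by exact: hs_sqnorm_fin.
have r_le x : ((r x)%:E <= 2%:E * q x + (2 * K)%:E)%E.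
  rewrite -rE EFinM; apply: (le_trans _ (leeD (lexx _) (lee_wpmul2l _ (GK x)))) => //.
  have {1}-> : DF x = ((fun w => DF x w - cm_diff (G n) x w) \+ cm_diff (G n) x)%R.
    by apply/funext => w /=; rewrite subrK.
  exact: hs_sqnormD.
(* [phi] is built from [r] alone, so it is measurable, and it satisfies both
   [phi <= q] and [r <= 2 phi + 2 K]: finiteness passes from [q^2] to [phi^2]
   by monotonicity, then from [phi^2] to [r^2] by linearity. *)
pose phi x := Num.max 0 (r x - 2 * K) / 2.
have phi0 x : 0 <= phi x by rewrite divr_ge0// le_max lexx.
have mphi : measurable_fun setT (phi : borel X -> R).
  apply: measurable_funM => //; apply: measurable_maxr => //.
  exact: measurable_funB.
have phi_q x : ((phi x)%:E <= q x)%E.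
  move: (q0 x) (r_le x).
  case: (q x) => [s s0|_ _|]; [|by rewrite leey|by rewrite leeNy_eq].
  rewrite -EFinM -EFinD !lee_fin /phi ler_pdivrMr// => rs.
  by rewrite ge_max mulr_ge0//=; move: rs; lra.
have iphi2 : gamma.-integrable setT (fun x => (phi x ^+ 2)%:E).
  apply/integrableP; split.
    by apply/measurable_EFinP; exact: measurable_funX.
  under eq_integral do rewrite gee0_abs ?lee_fin ?sqr_ge0//.
  apply: le_lt_trans q2fin; apply: ge0_le_integral_nonmeasurable => x.
    by rewrite lee_fin sqr_ge0.
  by rewrite expe2 expr2 EFinM lee_pmul// lee_fin.
have i8 := integrableD measurableT (integrableZl measurableT 8 iphi2)
  (finite_measure_integrable_cst gamma (8 * K ^+ 2) measurableT).
apply: le_integrable i8 => //.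
  by apply/measurable_EFinP; exact: measurable_funX.
move=> x _; rewrite -EFinM -EFinD !lee_fin.
rewrite ger0_norm ?sqr_ge0// ger0_norm; last first.
  by rewrite addr_ge0// mulr_ge0// sqr_ge0.
have r0 : 0 <= r x by exact: fine_hs_sqnorm_ge0.
have rphi : r x <= 2 * phi x + 2 * K.
  have : r x - 2 * K <= Num.max 0 (r x - 2 * K) by rewrite le_max lexx orbT.
  by rewrite /phi; lra.
apply: (@le_trans _ _ ((2 * phi x + 2 * K) ^+ 2)).
  by rewrite ler_sqr ?nnegrE// (le_trans r0).
have := sqr_ge0 (phi x - K); rewrite !expr2/=; lra.
Qed.

End fourth_moment.

(** * Sensitivity operators *)

Theorem proposition33 (R : realType) (X Y : hilbertType R)
  (sepX : separable X) (infX : infinite_dimensional X)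
  (sepY : separable Y) (infY : infinite_dimensional Y)
  (C : covariance_op X) (S : sqrt_cov C)
  (gamma : probability (borel X) R) (gammaC : centered_gaussian gamma C)
  (e : nat -> cameron_martin S) (e_onb : orthonormal_basis e)
  (f : nat -> Y) (f_onb : orthonormal_basis f)
  (F : X -> Y) (DF : X -> cameron_martin S -> Y)
  (F_W14 : sobolev14 gamma e F DF) :
  exists M_X M_Y : R,
    forall (N : nat) (d : measure_display) (Om : measurableType d)
      (P : probability Om R) (x : 'I_N -> Om -> borel X),
      (0 < N)%N -> iid_samples P gamma x ->
      (\int[P]_om hs_sqnorm e (sensitivity_X gamma DF
                                \- emp_sensitivity_X DF (x ^~ om))%R
        <= (M_X / N%:R)%:E)%E /\
      (\int[P]_om hs_sqnorm f (sensitivity_Y gamma DF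
                                \- emp_sensitivity_Y DF (x ^~ om))%R
        <= (M_Y / N%:R)%:E)%E.
Proof.
have [_ DF_hs mDF _] := F_W14.
pose r x := fine (hs_sqnorm e (DF x)).
have mr : measurable_fun setT (r : borel X -> R).
  exact: (@measurable_fine_hs_DF _ _ _ (borel X) _ DF e mDF).
have ir2 : gamma.-integrable setT (fun x => (r x ^+ 2)%:E).
  exact: (sobolev14_fourth_moment e_onb F_W14).
pose I2 := fine (\int[gamma]_x (r x ^+ 2)%:E).
exists I2, I2 => N d Om P x N0 x_iid.
have -> : ((I2 / N%:R)%:E = (N%:R^-1)%:E * \int[gamma]_x (r x ^+ 2)%:E)%E.
  by rewrite mulrC EFinM fineK// integrable_fin_num.
split.
- apply: (@random_operator_error _ (borel X) R gamma _ e e_onb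
    (fun x h => adjoint (DF x) (DF x h)) r) => //.
  + exact: (@measurable_adjointDF _ _ _ (borel X) _ DF e e_onb DF_hs mDF).
  + by move=> t h; exact: (norm_adjointT_le e_onb (DF_hs t)).
  + by move=> t; exact: (hs_sqnorm_adjointT_le e_onb (DF_hs t)).
- apply: (@random_operator_error _ (borel X) R gamma _ f f_onb
    (fun x v => DF x (adjoint (DF x) v)) r) => //.
  + exact: (@measurable_DFadjoint _ _ _ (borel X) _ DF e e_onb DF_hs mDF).
  + by move=> t v; exact: (norm_Tadjoint_le e_onb (DF_hs t)).
  + by move=> t; exact: (hs_sqnorm_Tadjoint_le e_onb f_onb (DF_hs t)).
Qed.
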